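(* The set ${\rm Prim}(D(R_A))=\{{\rm Ann}(L(\boldsymbol\alpha)):\boldsymbol\alpha\in\mathbb C^d\}$ is finite.
   Context: $A\subset\mathbb Z^d$ is a finite set generating the group $\mathbb Z^d$; $R_A=\mathbb C[\mathbb NA]\subseteq\mathbb C[t_1^{\pm1},\dots,t_d^{\pm1}]$; $D(R_A)=\{P\in\mathbb C[t^{\pm1}]\langle\partial_1,\dots,\partial_d\rangle:P(R_A)\subseteq R_A\}$; $s_j=t_j\partial_j$. $M(\boldsymbol\alpha)=D(R_A)/\sum_iD(R_A)(s_i-\alpha_i)$ has, in the category of left $D(R_A)$-modules that are direct sums of finite-dimensional weight spaces $\{x:f(s)x=f(\boldsymbol\lambda)x\ \forall f\in\mathbb C[s]\}$, a unique simple quotient $L(\boldsymbol\alpha)$; ${\rm Ann}$ denotes the annihilator ideal in $D(R_A)$. *)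

(* Defs.v *)
From HB Require Import structures.
From mathcomp Require Import all_boot all_order all_algebra.
From mathcomp Require Import finmap.
From mathcomp Require Import reals.
From mathcomp Require Import complex.
From mathcomp.multinomials Require Import monalg mpoly.

Set Implicit Arguments.
Unset Strict Implicit.
Unset Printing Implicit Defensive.

Import GRing.Theory Num.Theory.
Local Open Scope ring_scope.

Definition Cx (R : realType) := complex R.

Section ToricD.
Variable R : realType.
Variable d : nat.
Local Notation C := (Cx R).

Definition Zd := 'rV[int]_d.
Definition Spoly := {mpoly C[d]}.
Definition Laurent := {malg C[Zd]}.
(* Laurent differential operators C[t^{+-1}]<d_1,...,d_d>, in the normal form
   P = sum_a t^a f_a(s), f_a in C[s], s_j = t_j d_j. *)
Definition LDop := {malg Spoly[Zd]}.

Definition shift (b : Zd) (f : Spoly) : Spoly :=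
  f \mPo [tuple ('X_i + ((b 0 i)%:~R : C)%:MP) | i < d].

(* (t^a f(s)) (t^b g(s)) = t^(a+b) f(s+b) g(s) *)
Definition mulD (P Q : LDop) : LDop :=
  \sum_(a <- monalg.msupp P) \sum_(b <- monalg.msupp Q)
     monalg.mkmalgU (a + b) (shift b (monalg.mcoeff a P) * monalg.mcoeff b Q).

Definition oneD : LDop := monalg.mkmalgU (0 : Zd) (1 : Spoly).

(* action on Laurent polynomials: t^a f(s) . t^c = f(c) t^(a+c) *)
Definition actD (P : LDop) (f : Laurent) : Laurent :=
  \sum_(c <- monalg.msupp f) \sum_(a <- monalg.msupp P)
     monalg.mkmalgU (a + c)
       (monalg.mcoeff c f * (monalg.mcoeff a P).@[fun i => (c 0 i)%:~R]).

Variable A : seq Zd.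

Definition generates_Zd : Prop :=
  forall c : Zd, exists z : 'I_(size A) -> int, c = \sum_(i < size A) (A`_i) *~ z i.

Definition inNA (c : Zd) : Prop :=
  exists n : 'I_(size A) -> nat, c = \sum_(i < size A) (A`_i) *+ n i.

Definition inRA (f : Laurent) : Prop := forall c, c \in monalg.msupp f -> inNA c.

Definition inD (P : LDop) : Prop := forall f, inRA f -> inRA (actD P f).

Definition left_ideal (J : LDop -> Prop) : Prop :=
  [/\ forall P, J P -> inD P, J 0,
      forall P Q, J P -> J Q -> J (P + Q) &
      forall P Q, inD P -> J Q -> J (mulD P Q)].

Definition maximal_left_ideal (J : LDop -> Prop) : Prop :=
  [/\ left_ideal J, ~ J oneD &
      forall J', left_ideal J' -> (forall P, J P -> J' P) -> ~ J' oneD ->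
                 forall P, J' P -> J P].

Definition s_minus (alpha : 'I_d -> C) (i : 'I_d) : LDop :=
  monalg.mkmalgU (0 : Zd) ('X_i - (alpha i)%:MP : Spoly).

(* J is a maximal left ideal containing sum_i D(R_A)(s_i - alpha_i), i.e.
   D(R_A)/J is a simple quotient of M(alpha) = L(alpha). *)
Definition L_ideal (alpha : 'I_d -> C) (J : LDop -> Prop) : Prop :=
  maximal_left_ideal J /\ forall i, J (s_minus alpha i).

(* Ann(D(R_A)/J) = { P in D(R_A) : P Q in J for all Q in D(R_A) } *)
Definition Ann (J : LDop -> Prop) (P : LDop) : Prop :=
  inD P /\ forall Q, inD Q -> J (mulD P Q).

End ToricD.

(* Main.v *)
Require Import Defs.
From HB Require Import structures.
From mathcomp Require Import all_boot all_order all_algebra.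
From mathcomp Require Import finmap ring zify.
From mathcomp Require Import boolp reals complex.
From mathcomp.multinomials Require Import monalg.
From mathcomp.multinomials Require Import mpoly.

(* Write S = NA and, for a set F of generators, S_F = S + ZF.  Call x below
   x + b (b in Z^d) when some t^b g in D(R_A) has g(x) <> 0.  The maximal left
   ideal defining L(alpha) is forced to be {P : (QP)_0(alpha) = 0 for all Q in
   D(R_A)}, so a component t^a f of an operator annihilates L(alpha) iff f
   vanishes at every point alpha + b above alpha with alpha + b + a below alpha.
   Since S \ (S - b) is a finite union of translated cones c + NF, the point x
   is below x + b iff x - y in S_F implies x + b - y in S_F for all F and all y
   in CF.

   Only the F with x in CF + Z^d matter in this criterion.  If w lies in all
   these CF, then translating alpha by w (without creating new such F) carries
   the above set of points to itself plus w; as that set is also stable under a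
   lattice spanning the space of all such w, its vanishing polynomials do not
   see the translation.  Modulo these translations, alpha is determined by the
   collection of F, a residue of an integer vector, and an element z of Z^d
   which matters only through finitely many membership conditions modulo a
   common exponent M of the groups (CF cap Z^d) / ZF. *)

Set Implicit Arguments.
Unset Strict Implicit.
Unset Printing Implicit Defensive.

Import Order.TTheory GRing.Theory Num.Theory.
Local Open Scope ring_scope.

(** * Integral pseudo-inverses up to a scalar *)

Section IntegerMatrices.

Lemma clear_denominators m n (Q : 'M[rat]_(m, n)) :
  exists2 N : nat, (0 < N)%N &
    exists P : 'M[int]_(m, n), map_mx intr P = N%:R *: Q.
Proof.
pose den (k : 'I_m * 'I_n) := `|denq (Q k.1 k.2)|%N.
exists (\prod_k den k)%N.
  by rewrite prodn_gt0 // => k; rewrite absz_gt0 denq_neq0.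
exists (\matrix_(i, j) (numq (Q i j) * (\prod_(k | k != (i, j)) den k)%N%:Z)).
apply/matrixP => i j; rewrite !mxE [X in _ = X%:R * _](bigD1 (i, j)) //= natrM.
have denE : (den (i, j))%:R = (denq (Q i j))%:~R :> rat.
  by rewrite pmulrn /den /= absz_denq.
by rewrite rmorphM /= numqE -pmulrn denE; ring.
Qed.

Lemma intr_mx_inj (L : numDomainType) m n :
  injective (@map_mx int L intr m n).
Proof.
move=> M M' /matrixP eqM; apply/matrixP => i j.
by have := eqM i j; rewrite !mxE => /intr_inj.
Qed.

(** Clear denominators in a rational pseudo-inverse. The factor [N] this costs is the source of the
    exponents and moduli used later. *)
Lemma integer_pinv m n (M : 'M[int]_(m, n)) :
  exists2 N : nat, (0 < N)%N &
    exists P : 'M[int]_(n, m), M *m P *m M = N%:R *: M.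
Proof.
pose MQ := map_mx (intr : int -> rat) M.
have [N N_gt0 [P PE]] := clear_denominators (pinvmx MQ).
exists N => //; exists P.
apply: (@intr_mx_inj rat).
rewrite !map_mxM PE -scalemxAr -scalemxAl mulmxKpV // map_mxZ rmorph_nat //.
Qed.

End IntegerMatrices.

(** * Subspaces defined over the integers *)

Section IntegerSubspaces.
Variables (K : numFieldType).

Definition mxK m n (M : 'M[int]_(m, n)) : 'M[K]_(m, n) := map_mx intr M.

Lemma mxKM m n p (M : 'M[int]_(m, n)) (M' : 'M[int]_(n, p)) :
  mxK (M *m M') = mxK M *m mxK M'.
Proof. exact: map_mxM. Qed.

Lemma mxKD m n (M M' : 'M[int]_(m, n)) : mxK (M + M') = mxK M + mxK M'.
Proof. exact: map_mxD. Qed.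

Lemma mxKB m n (M M' : 'M[int]_(m, n)) : mxK (M - M') = mxK M - mxK M'.
Proof. exact: map_mxB. Qed.

Lemma mxK0 m n : mxK (0 : 'M_(m, n)) = 0.
Proof. exact: map_mx0. Qed.

Lemma mxKZ m n N (M : 'M[int]_(m, n)) : mxK (N%:R *: M) = N%:R *: mxK M.
Proof. by rewrite /mxK map_mxZ rmorph_nat. Qed.

Lemma mxK_inj m n : injective (@mxK m n).
Proof. exact: intr_mx_inj. Qed.

(** With [M P M = N M], the matrix [B = N - P M] is killed by the rows of [M], and [x B = 0] reads
    [N x = (x P) M]. For integral [x] the coefficients [x P] are integral, hence the second
    clause. *)
Lemma row_span_ker m n (M : 'M[int]_(m, n)) :
  exists2 N : nat, (0 < N)%N & exists B : 'M[int]_n,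
    (forall x : 'rV[K]_n, (exists c, x = c *m mxK M) <-> x *m mxK B = 0) /\
    (forall z : 'rV[int]_n, z *m B = 0 -> exists k, N%:R *: z = k *m M).
Proof.
have [N N_gt0 [P PE]] := integer_pinv M.
exists N => //; exists (N%:R%:M - P *m M); split=> [x|z].
  rewrite mxKB mulmxBr mxKM -[mxK (scalar_mx _)]/(map_mx _ _) map_scalar_mx /=.
  rewrite rmorph_nat mul_mx_scalar; split=> [[c ->]|/eqP].
    by rewrite -!mulmxA -!mxKM mulmxA PE mxKZ -scalemxAr subrr.
  rewrite subr_eq0 => /eqP xE; exists (N%:R^-1 *: (x *m mxK P)).
  by rewrite -scalemxAl -mulmxA -xE scalerA mulVf ?scale1r // pnatr_eq0 -lt0n.
rewrite mulmxBr mul_mx_scalar mulmxA => /eqP; rewrite subr_eq0 => /eqP ->.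
by exists (z *m P).
Qed.

(** Let [B P B = N B]. If [x B = y] is integral, then so is [y P], and [N x - y P] lies in the
    kernel. The rows of [N - B P] span that kernel. *)
Lemma ker_split m n (B : 'M[int]_(m, n)) :
  exists2 N : nat, (0 < N)%N &
  (forall (x : 'rV[K]_m) y, x *m mxK B = mxK y ->
     exists w z, w *m mxK B = 0 /\ N%:R *: x = w + mxK z) /\
  exists2 U : 'M[int]_m, U *m B = 0 &
     forall w : 'rV[K]_m, w *m mxK B = 0 -> exists c, w = c *m mxK U.
Proof.
have [N N_gt0 [P PE]] := integer_pinv B.
exists N => //; split=> [x y xE|].
  exists (N%:R *: x - mxK (y *m P)), (y *m P); split; last by rewrite subrK.
  rewrite mulmxBl -scalemxAl mxKM -xE -!mulmxA -!mxKM mulmxA PE mxKZ.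
  by rewrite -scalemxAr subrr.
exists (N%:R%:M - B *m P) => [|w wB].
  by rewrite mulmxBl PE mul_scalar_mx subrr.
exists (N%:R^-1 *: w).
rewrite mxKB mulmxBr mxKM -[mxK (scalar_mx _)]/(map_mx _ _) map_scalar_mx /=.
rewrite rmorph_nat mul_mx_scalar mulmxA -!scalemxAl wB mul0mx scaler0 subr0.
by rewrite scalerA mulfV ?scale1r // pnatr_eq0 -lt0n.
Qed.

(** Juxtaposing the blocks presents an intersection of kernels as one kernel, to which [ker_split]
    can be applied. *)
Lemma stack_mx (T : finType) d (B : T -> 'M[int]_d) :
  exists m (B' : 'M[int]_(d, m)),
    (forall x : 'rV[K]_d, (forall t, x *m mxK (B t) = 0) <-> x *m mxK B' = 0) /\
    (forall x : 'rV[K]_d, (forall t, exists y, x *m mxK (B t) = mxK y) ->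
        exists y, x *m mxK B' = mxK y).
Proof.
exists (\sum_(i < #|T|) d)%N, (\mxrow_i (B (enum_val i))).
have E x : x *m mxK (\mxrow_i (B (enum_val i))) =
  \mxrow_i (x *m mxK (B (enum_val i))).
  rewrite -mul_mxrow; congr (_ *m _); apply/matrixP => i j.
  by rewrite !mxE.
split=> x.
  rewrite E; split=> [H|H t].
    by rewrite -[RHS]mxrow0; apply: eq_mxrow => i; rewrite H.
  have := congr1 (fun M => submxrow M (enum_rank t)) H.
  by rewrite mxrowK submxrow0 enum_rankK.
case/choice => y yE; exists (\mxrow_i (y (enum_val i))).
rewrite E (eq_mxrow (fun i => yE (enum_val i))).
by apply/matrixP => i j; rewrite !mxE.
Qed.

End IntegerSubspaces.

(** * Zariski density of lattice points *)

Section Vanishing.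
Variables (K : numFieldType) (d : nat).
Implicit Types (f : mpoly.mpoly d K) (x v : 'rV[K]_d).

Definition ev f x := f.@[fun i => x 0 i].

Lemma ev_line f x v : exists p : {poly K}, forall t, p.[t] = ev f (x + t *: v).
Proof.
elim/mpolyind: f => [|c m f _ _ [p pE]].
  by exists 0 => t; rewrite horner0 /ev meval0.
exists (c%:P * \prod_i ((x 0 i)%:P + (v 0 i)%:P * 'X) ^+ m i + p) => t.
rewrite hornerD pE /ev mevalD mevalZ mevalX hornerM hornerC horner_prod.
congr (_ * _ + _); apply: eq_bigr => i _.
by rewrite horner_exp !hornerE !mxE [v 0 i * t]mulrC.
Qed.

(** In characteristic zero the natural numbers are infinitely many roots of the restriction of [f]
    to the line. *)
Lemma ev_line_eq0 f x v :
  (forall k : nat, ev f (x + k%:R *: v) = 0) -> forall t, ev f (x + t *: v) = 0.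
Proof.
move=> f0 t; have [p pE] := ev_line f x v; rewrite -pE.
suff -> : p = 0 by rewrite horner0.
apply/eqP/negPn/negP => /max_poly_roots pr.
have := pr [seq k%:R | k <- iota 0 (size p)].
rewrite size_map size_iota ltnn => H; suff: false by []; apply: H.
  by apply/allP => _ /mapP[k _ ->]; apply/rootP; rewrite pE.
rewrite map_inj_uniq ?iota_uniq // => k k' /eqP.
by rewrite eqr_nat => /eqP.
Qed.

Lemma ev_span_eq0 f m (U : 'M[K]_(m, d)) (Y : 'rV[K]_d -> Prop) :
  (forall y i, Y y -> Y (y + row i U)) -> (forall y, Y y -> ev f y = 0) ->
  forall y c, Y y -> ev f (y + c *m U) = 0.
Proof.
move=> YU Y0 y c Yy; rewrite mulmx_sum_row.
(* [y] stays general: the induction hypothesis is used at every [y + k *: row i U] with [k] natural,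
   and [ev_line_eq0] then fills in the line through these points. *)
elim: (index_enum _) y Yy => [|i s IHs] y Yy.
  by rewrite big_nil addr0; apply: Y0.
rewrite big_cons addrCA addrC; apply: ev_line_eq0 => k.
rewrite addrAC; apply: IHs; elim: k => [|k IHk]; first by rewrite scale0r addr0.
by rewrite -natr1 scalerDl scale1r addrA; apply: YU.
Qed.

End Vanishing.

Lemma mcoeff_sum (T : choiceType) (G : zmodType) (I : Type) (r : seq I)
    (F : I -> monalg.malg T G) k :
  monalg.mcoeff k (\sum_(i <- r) F i) = \sum_(i <- r) monalg.mcoeff k (F i).
Proof.
by elim/big_ind2: _ => [|x1 x2 y1 y2 <- <-|//];
  [rewrite monalg.mcoeff0 | rewrite monalg.mcoeffD].
Qed.

(** * Graded calculus of operators, and membership in D(R_A) *)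

Section Operators.
Variables (R : realType) (d : nat).
Local Notation C := (Cx R).
Local Notation zc := (@mxK C 1 d).
Implicit Types (P Q : LDop R d) (f g : Spoly R d) (a b c k : Zd d).

(* The types of [wcoef] and [monom] are fixed once and for all, so that failing
   unifications do not unfold the polynomial structures. *)
Definition wcoef k P : Spoly R d := monalg.mcoeff k P.
Definition monom a f : LDop R d := monalg.mkmalgU a f.

Lemma wcoefP P Q : (forall k, wcoef k P = wcoef k Q) -> P = Q.
Proof. by move=> PQ; apply/monalg.malgP. Qed.

Lemma wcoef0 k : wcoef k 0 = 0.
Proof. exact: monalg.mcoeff0. Qed.

Lemma wcoefD k P Q : wcoef k (P + Q) = wcoef k P + wcoef k Q.
Proof. exact: monalg.mcoeffD. Qed.

Lemma wcoefN k P : wcoef k (- P) = - wcoef k P.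
Proof. exact: monalg.mcoeffN. Qed.

Lemma wcoef_monom k a f : wcoef k (monom a f) = if a == k then f else 0.
Proof. by rewrite /wcoef monalg.mcoeffU; case: eqP. Qed.

Lemma wcoef_neq0 k P : (wcoef k P != 0) = (k \in monalg.msupp P).
Proof. exact: monalg.mcoeff_neq0. Qed.

Lemma monomD a f g : monom a (f + g) = monom a f + monom a g.
Proof. exact: monalg.monalgUD. Qed.

Lemma monomN a f : monom a (- f) = - monom a f.
Proof. exact: monalg.monalgUN. Qed.

Lemma monom0 a : monom a 0 = 0.
Proof. exact: monalg.monalgU0. Qed.

Lemma msupp_monom a f : f != 0 -> monalg.msupp (monom a f) = [fset a]%fset.
Proof. by move=> f0; rewrite /monom monalg.msuppU (negPf f0). Qed.

Lemma ev_shift b f x : ev (shift b f) x = ev f (x + zc b).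
Proof.
rewrite /ev comp_mpoly_meval; apply: meval_eq => i.
by rewrite tnth_mktuple mevalD mevalXU mevalC !mxE.
Qed.


Lemma ev0 x : ev (0 : Spoly R d) x = 0.
Proof. exact: meval0. Qed.

Lemma ev1 x : ev (1 : Spoly R d) x = 1.
Proof. exact: meval1. Qed.

Lemma ev_const (l : C) x : ev (l%:MP : Spoly R d) x = l.
Proof. exact: mevalC. Qed.

Lemma evX i x : ev ('X_i : Spoly R d) x = x 0 i.
Proof. exact: mevalXU. Qed.

Lemma evD f g x : ev (f + g) x = ev f x + ev g x.
Proof. exact: mevalD. Qed.

Lemma evM f g x : ev (f * g) x = ev f x * ev g x.
Proof. exact: mevalM. Qed.

Lemma ev_sum (I : Type) (r : seq I) (F : I -> Spoly R d) x :
  ev (\sum_(i <- r) F i) x = \sum_(i <- r) ev (F i) x.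
Proof. exact: raddf_sum. Qed.

Lemma ev_zc f c : f.@[fun i => (c 0 i)%:~R] = ev f (zc c).
Proof. by apply: meval_eq => i; rewrite mxE. Qed.

Lemma shift0 f : shift 0 f = f.
Proof.
rewrite /shift.
have -> : [tuple ('X_i + ((0 : Zd d) 0 i)%:~R%:MP : Spoly R d) | i < d] =
    [tuple 'X_i | i < d].
  by apply: eq_mktuple => i; rewrite mxE mulr0z mpolyC0 addr0.
exact: comp_mpoly_id.
Qed.

Lemma shift_const b (l : C) : shift b (l%:MP : Spoly R d) = l%:MP.
Proof. exact: comp_mpolyC. Qed.

Lemma shift_poly0 b : shift b (0 : Spoly R d) = 0.
Proof. exact: comp_mpoly0. Qed.

Lemma shiftXB b i (l : C) :
  shift b ('X_i - l%:MP : Spoly R d) = 'X_i + ((b 0 i)%:~R : C)%:MP - l%:MP.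
Proof.
by rewrite /shift comp_mpolyB comp_mpolyXU comp_mpolyC -tnth_nth tnth_mktuple.
Qed.

Lemma wcoef_mulD P Q k :
  wcoef k (mulD P Q) =
  \sum_(a <- monalg.msupp P) shift (k - a) (wcoef a P) * wcoef (k - a) Q.
Proof.
rewrite /wcoef /mulD mcoeff_sum; apply: eq_bigr => a _; rewrite mcoeff_sum.
have E b : monalg.mcoeff k (monom (a + b) (shift b (wcoef a P) * wcoef b Q)) =
    if b == k - a then shift b (wcoef a P) * wcoef b Q else 0.
  rewrite -/(wcoef k _) wcoef_monom.
  have -> // : (b == k - a) = (a + b == k).
  by rewrite eq_sym subr_eq addrC eq_sym.
transitivity (\sum_(b <- monalg.msupp Q)
  if b == k - a then shift b (wcoef a P) * wcoef b Q else 0).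
  by apply: eq_bigr => b _; exact: E.
case: (boolP (k - a \in monalg.msupp Q)) => [kQ|kQ].
  rewrite (bigD1_seq (k - a)) ?fset_uniq //= eqxx big1 ?addr0 // => b /negPf ->.
  by [].
transitivity (0 : Spoly R d).
  rewrite big_seq; apply: big1 => b bQ.
  by case: eqP => // bE; rewrite -bE bQ in kQ.
have -> : monalg.mcoeff (k - a) Q = 0 := monalg.mcoeff_outdom kQ.
by rewrite mulr0.
Qed.

Lemma wcoef_monomM a f Q k :
  wcoef k (mulD (monom a f) Q) = shift (k - a) f * wcoef (k - a) Q.
Proof.
rewrite wcoef_mulD; have [->|f0] := eqVneq f 0.
  by rewrite monom0 monalg.msupp0 big_seq_fset0 shift_poly0 mul0r.
by rewrite msupp_monom // big_seq_fset1 wcoef_monom eqxx.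
Qed.

Lemma wcoef_mulmonom P b g k :
  wcoef k (mulD P (monom b g)) = shift b (wcoef (k - b) P) * g.
Proof.
rewrite wcoef_mulD.
transitivity (\sum_(a <- monalg.msupp P)
    if a == k - b then shift b (wcoef (k - b) P) * g else 0).
  apply: eq_bigr => a _; rewrite wcoef_monom.
  have -> : (b == k - a) = (a == k - b).
    by rewrite eq_sym subr_eq addrC -subr_eq eq_sym.
  case: eqP => [->|_]; last exact: mulr0.
  by rewrite opprB addrC subrK.
case: (boolP (k - b \in monalg.msupp P)) => [kP|kP].
  rewrite (bigD1_seq (k - b)) ?fset_uniq //= eqxx big1 ?addr0 //.
  by move=> a /negPf->.
have -> : wcoef (k - b) P = 0 := monalg.mcoeff_outdom kP.
rewrite shift_poly0 mul0r.
by apply: big1 => a _; case: ifP.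
Qed.

Lemma mulD_monom a f b g :
  mulD (monom a f) (monom b g) = monom (a + b) (shift b f * g).
Proof.
apply/wcoefP => k; rewrite wcoef_monomM !wcoef_monom.
have -> : (b == k - a) = (a + b == k) by rewrite eq_sym subr_eq addrC eq_sym.
case: eqP => [<-|_]; last exact: mulr0.
by rewrite addrC addKr.
Qed.

Variable A : seq (Zd d).

Definition vanishOut b f :=
  forall c, inNA A c -> ~ inNA A (b + c) -> ev f (zc c) = 0.

(** Applied to t^c, components of distinct degrees give distinct monomials, so nothing cancels. Thus
    D(R_A) is graded by Z^d. *)
Lemma inDP P : inD A P <-> forall b, vanishOut b (wcoef b P).
Proof.
split=> [PD b c cA bcA|PD h hA k].
  apply/eqP/negPn/negP => Pbc; apply: bcA.
  apply: (PD (monalg.mkmalgU c 1)).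
    move=> c' /(fsubsetP monalg.msuppU_le); rewrite in_fset1 => /eqP -> //.
  rewrite -monalg.mcoeff_neq0 /actD mcoeff_sum monalg.msuppU oner_eq0.
  rewrite big_seq_fset1 mcoeff_sum (bigD1_seq b) ?fset_uniq //=; last first.
    by rewrite -wcoef_neq0; apply: contraNneq Pbc => ->; rewrite ev0.
  rewrite !monalg.mcoeffU !eqxx mul1r ev_zc big1 ?addr0 // => a ab.
  by rewrite monalg.mcoeffU (inj_eq (addIr c)) (negPf ab).
rewrite -monalg.mcoeff_neq0; case: (pselect (inNA A k)) => // kA.
rewrite /actD mcoeff_sum big_seq big1 ?eqxx // => c cf.
rewrite mcoeff_sum big1 // => a _; rewrite monalg.mcoeffU.
case: eqP => [acE|//]; rewrite ev_zc PD ?mulr0 //; first exact: hA.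
by rewrite acE.
Qed.

Lemma inD_monom b f : inD A (monom b f) <-> vanishOut b f.
Proof.
rewrite inDP; split=> [/(_ b)|fb b' c cA b'cA].
  by rewrite wcoef_monom eqxx.
rewrite wcoef_monom; case: eqP b'cA => [<- bcA|_ _]; last exact: ev0.
exact: fb.
Qed.

Lemma vanishOutM a b f g :
  vanishOut a f -> vanishOut b g -> vanishOut (a + b) (shift b f * g).
Proof.
move=> fa gb c cA abcA; rewrite evM ev_shift.
case: (pselect (inNA A (b + c))) => bcA; last by rewrite gb ?mulr0.
by rewrite -mxKD [c + b]addrC fa ?mul0r // addrA.
Qed.

Lemma inD0 : inD A (0 : LDop R d).
Proof. by apply/inDP => b c _ _; rewrite wcoef0 ev0. Qed.

Lemma inDD P Q : inD A P -> inD A Q -> inD A (P + Q).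
Proof.
move=> /inDP PD /inDP QD; apply/inDP => b c cA bcA.
by rewrite wcoefD evD PD // QD // addr0.
Qed.

Lemma inDM P Q : inD A P -> inD A Q -> inD A (mulD P Q).
Proof.
move=> /inDP PD /inDP QD; apply/inDP => k c cA kcA.
rewrite wcoef_mulD ev_sum big1 // => a _.
have kE : a + (k - a) = k by rewrite addrC subrK.
by apply: (vanishOutM (PD a) (QD (k - a)) cA); rewrite kE.
Qed.

Lemma inD_poly f : inD A (monom 0 f).
Proof. by apply/inD_monom => c cA; rewrite add0r. Qed.

End Operators.

(** * The maximal left ideal of L(alpha) and its annihilator *)

Section SimpleQuotient.
Variables (R : realType) (d : nat) (A : seq (Zd d)).
Local Notation C := (Cx R).
Local Notation zc := (@mxK C 1 d).
Implicit Types (P Q : LDop R d) (f g h : Spoly R d) (a b c k : Zd d).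
Implicit Types (x : 'rV[C]_d).

Lemma s_minusE (alpha : 'I_d -> C) i :
  s_minus alpha i = monom 0 ('X_i - (alpha i)%:MP).
Proof. by []. Qed.

Lemma oneDE : oneD R d = monom 0 1.
Proof. by []. Qed.

(* Otherwise, failing unifications unfold the product of operators. *)
#[local] Opaque mulD monom wcoef shift ev.

(** The displayed product is the degree 0 coefficient at [x] of [Q P] for the homogeneous operator
    [Q] = t^(-a) h(s). *)
Definition maxJ x P :=
  inD A P /\ forall a h, vanishOut A (- a) h ->
    ev h (x + zc a) * ev (wcoef a P) x = 0.

(** Each component of [Q] is absorbed into the test operator: t^(-a) h times the degree [b] part of
    [Q] is again a test operator, of degree [- (a - b)]. *)
Lemma maxJ_mul x P Q : inD A Q -> maxJ x P -> maxJ x (mulD Q P).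
Proof.
move=> QD [PD Px]; split=> [|a h ha]; first exact: inDM.
rewrite wcoef_mulD ev_sum mulr_sumr big1 // => b _.
rewrite evM ev_shift mulrA.
have := Px (a - b) (shift b h * wcoef b Q).
rewrite evM ev_shift -[x + _ + _]addrA -mxKD subrK; apply.
have -> : - (a - b) = - a + b by rewrite opprB addrC.
by apply: vanishOutM => //; move/inDP: QD.
Qed.

Lemma maxJ_left_ideal x : left_ideal A (maxJ x).
Proof.
split=> [P []//||P Q [PD Px] [QD Qx]|P Q PD Qx].
- by split=> [|a h _]; [exact: inD0 | rewrite wcoef0 ev0 mulr0].
- split=> [|a h ha]; first exact: inDD.
  by rewrite wcoefD evD mulrDr Px // Qx // addr0.
- exact: maxJ_mul.
Qed.

Lemma maxJ_one x : ~ maxJ x (oneD R d).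
Proof.
case=> _ /(_ 0 1); rewrite oneDE wcoef_monom eqxx !ev1 mulr1 => H.
have : (1 : C) = 0 by apply: H => c cA; rewrite oppr0 add0r.
by move/eqP; rewrite oner_eq0.
Qed.

Lemma wcoef_mul0 f P k : wcoef k (mulD (monom 0 f) P) = shift k f * wcoef k P.
Proof. by rewrite wcoef_monomM subr0. Qed.

Section LIdeal.
Variables (alpha : 'I_d -> C) (J : LDop R d -> Prop).
Hypothesis JL : L_ideal A alpha J.
Let x : 'rV[C]_d := \row_i alpha i.

Let J_ideal : left_ideal A J.
Proof. by case: JL => [[]]. Qed.

Let J_inD P : J P -> inD A P.
Proof. by case: J_ideal => H _ _ _; apply: H. Qed.

Let JD P Q : J P -> J Q -> J (P + Q).
Proof. by case: J_ideal => _ _ H _; apply: H. Qed.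

Let JM P Q : inD A P -> J Q -> J (mulD P Q).
Proof. by case: J_ideal => _ _ _; apply. Qed.

Let JN P : J P -> J (- P).
Proof.
move=> JP; have -> : - P = mulD (monom 0 (- 1)%:MP) P.
  apply/wcoefP => k; rewrite wcoef_mul0 wcoefN.
  by rewrite shift_const mpolyCN mpolyC1 mulN1r.
exact/JM/JP/inD_poly.
Qed.

Let J_eq f : J (monom 0 f) -> forall g, g = f -> J (monom 0 g).
Proof. by move=> Jf g ->. Qed.

Let Jpoly_add f g : J (monom 0 f) -> J (monom 0 g) -> J (monom 0 (f + g)).
Proof. by move=> Jf Jg; rewrite monomD; exact: (JD Jf Jg). Qed.

Let Jpoly_mul f g : J (monom 0 g) -> J (monom 0 (f * g)).
Proof.
move=> Jg; have := JM (@inD_poly R d A f) Jg.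
by rewrite mulD_monom shift0 addr0.
Qed.

Let J_scalars f : J (monom 0 (f - (ev f x)%:MP)).
Proof.
pose H f := J (monom 0 (f - (ev f x)%:MP)).
have HD f1 f2 : H f1 -> H f2 -> H (f1 + f2).
  move=> H1 H2; apply: (J_eq (Jpoly_add H1 H2)).
  by rewrite evD mpolyCD opprD addrACA.
have HM f1 f2 : H f1 -> H f2 -> H (f1 * f2).
  move=> H1 H2.
  apply: (J_eq (Jpoly_add (Jpoly_mul f1 H2) (Jpoly_mul (ev f2 x)%:MP H1))).
  by rewrite evM mpolyCM; ring.
have HC (l : C) : H (l%:MP).
  rewrite /H ev_const subrr monom0; by case: J_ideal.
have HX i : H 'X_i.
  by rewrite /H evX mxE; rewrite -s_minusE; exact: (proj2 JL i).
have H0 : H 0 by have := HC 0; rewrite mpolyC0; exact.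
have H1 : H 1 by have := HC 1; rewrite mpolyC1; exact.
suff: H f by exact.
elim/mpolyind: f => [|l m f _ _ Hf]; first exact: H0.
apply: (HD _ _ _ Hf); rewrite -mul_mpolyC; apply: (HM _ _ (HC l)).
rewrite mpolyXE_id; elim/big_ind: _ => [|f1 f2|i _]; [exact: H1|exact: HM|].
elim: (m i) => [|e IH]; first by rewrite expr0; exact: H1.
by rewrite exprS; exact: (HM _ _ (HX i) IH).
Qed.

(** A left ideal containing all s_i - alpha_i is compatible with the weight grading. Components of
    nonzero degree are removed one by one; a degree 0 element with nonzero value at [x] would put 1
    in [J]. *)
Lemma L_ideal_coef0 P : J P -> ev (wcoef 0 P) x = 0.
Proof.
have [n] := ubnP #|`monalg.msupp P|; elim: n P => // n IHn P Pn JP.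
apply/eqP/negPn/negP => P0.
have [[a [i [aP ai]]]|noa] :=
    pselect (exists a i, a \in monalg.msupp P /\ a 0 i != 0).
  pose p : Spoly R d := 'X_i - (alpha i)%:MP.
  pose q : Spoly R d := 'X_i - (alpha i + (a 0 i)%:~R)%:MP.
  (* [T] multiplies the degree [k] component by the scalar [(k - a) 0 i]: degree [a] disappears, and
     degree 0 survives because [a 0 i] is nonzero. *)
  pose T := mulD (monom 0 q) P - mulD P (monom 0 p).
  have TE k : wcoef k T = (((k - a) 0 i)%:~R : C)%:MP * wcoef k P.
    have E1 := wcoef_mul0 q P k.
    have E2 := wcoef_mulmonom P 0 p k; rewrite subr0 shift0 in E2.
    transitivity (shift k q * wcoef k P - wcoef k P * p).
      rewrite /T wcoefD wcoefN; exact: (f_equal2 (fun u v => u - v) E1 E2).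
    rewrite shiftXB !mxE mpolyCD rmorphB /= mpolyCB /p; ring.
  have JT : J T.
    have J1 := JM (@inD_poly R d A q) JP.
    have Jp : J (monom 0 p) by rewrite -s_minusE; exact: (proj2 JL i).
    have J2 := JN (JM (J_inD JP) Jp).
    exact: (JD J1 J2).
  have Tn : (#|` monalg.msupp T| < n)%N.
    rewrite ltnS in Pn; apply: leq_trans Pn; apply: fproper_ltn_card.
    rewrite fproperE; apply/andP; split.
      apply/fsubsetP => k; rewrite -!wcoef_neq0 TE; apply: contraNneq => ->.
      by rewrite mulr0.
    apply/negP => /fsubsetP/(_ a aP).
    by rewrite -wcoef_neq0 TE subrr mxE mpolyC0 mul0r eqxx.
  have /eqP := IHn T Tn JT; rewrite TE evM ev_const mulf_eq0 (negPf P0).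
  by rewrite orbF intr_eq0 !mxE add0r oppr_eq0 (negPf ai).
have PE : P = monom 0 (wcoef 0 P).
  apply/wcoefP => k; rewrite wcoef_monom; case: eqP => [->//|/eqP k0].
  apply: monalg.mcoeff_outdom; apply/negP => kP; apply: noa.
  exists k; apply: contrapT => nk; case/eqP: k0; apply/rowP => i.
  rewrite mxE; apply/eqP; rewrite eq_sym; apply/negPn/negP => ki; apply: nk.
  by exists i.
case: JL => [[_ J1 _] _]; apply: J1; rewrite oneDE.
have J0 : J (monom 0 (ev (wcoef 0 P) x)%:MP).
  have -> : (ev (wcoef 0 P) x)%:MP =
    wcoef 0 P - (wcoef 0 P - (ev (wcoef 0 P) x)%:MP) :> Spoly R d by ring.
  rewrite monomD monomN -PE; exact: (JD JP (JN (J_scalars _))).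
have := JM (@inD_poly R d A ((ev (wcoef 0 P) x)^-1%:MP)) J0.
rewrite mulD_monom shift0 addr0 -mpolyCM mulVf //.
Qed.

(** [L_ideal_coef0] applied to the products [Q P] puts [J] inside [maxJ x]; as the latter is a
    proper left ideal, maximality of [J] gives equality. *)
Lemma L_idealE P : J P <-> maxJ x P.
Proof.
have sub Q : J Q -> maxJ x Q.
  move=> JQ; split=> [|a h ha]; first exact: J_inD.
  have := L_ideal_coef0 (JM _ JQ : J (mulD (monom (- a) h) Q)).
  rewrite wcoef_monomM sub0r opprK evM ev_shift; apply.
  exact/inD_monom.
split; first exact: sub.
have [[_ _ maxJ_max] _] := JL.
exact: (maxJ_max (maxJ x) (maxJ_left_ideal x) sub (@maxJ_one x)).
Qed.

End LIdeal.

(** Homogeneous form of the annihilator: go from weight [x] to [x + b] by t^b g, apply the degree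
    [a] part of [P], and return to [x] by t^(-(a+b)) h. *)
Definition annL x P :=
  inD A P /\ forall a b g h, vanishOut A b g -> vanishOut A (- (a + b)) h ->
    ev h (x + zc (a + b)) * (ev (wcoef a P) (x + zc b) * ev g x) = 0.

Lemma AnnE alpha J P : L_ideal A alpha J ->
  Ann A J P <-> annL (\row_i alpha i) P.
Proof.
move=> JL; split=> -[PD PJ]; split=> //.
  move=> a b g h gb hab.
  have /(L_idealE JL)[_ /(_ (a + b) h hab)] :=
    PJ (monom b g) (proj2 (inD_monom _ _ _) gb).
  by rewrite wcoef_mulmonom addrK evM ev_shift.
move=> Q QD; apply/(L_idealE JL); split=> [|k h hk]; first exact: inDM.
rewrite wcoef_mulD ev_sum mulr_sumr big1 // => a _.
rewrite evM ev_shift.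
have kE : a + (k - a) = k by rewrite addrC subrK.
have := PJ a (k - a) (wcoef (k - a) Q) h; rewrite kE; apply=> //.
by move/inDP: QD.
Qed.

End SimpleQuotient.

(** * Localisations of NA and the preorder on weights *)

Section Localisations.
Variables (R : realType) (d : nat) (A : seq (Zd d)).
Local Notation C := (Cx R).
Local Notation zc := (@mxK C 1 d).
Local Notation I := ('I_(size A)).
Implicit Types (F : {set I}) (m : I -> nat) (a b z : Zd d).
Implicit Types (x y w : 'rV[C]_d).

Definition comb F m : Zd d := \sum_(i in F) A`_i *+ m i.

Lemma inNA0 : inNA A (0 : Zd d).
Proof. by exists (fun=> 0%N); rewrite big1. Qed.

Lemma inNAD a b : inNA A a -> inNA A b -> inNA A (a + b).
Proof.
move=> [m ->] [m' ->]; exists (fun i => m i + m' i)%N.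
by rewrite -big_split; apply: eq_bigr => i _; rewrite /= mulrnDr.
Qed.

Lemma inNA_comb F m : inNA A (comb F m).
Proof.
exists (fun i => if i \in F then m i else 0%N); rewrite /comb big_mkcond.
by apply: eq_bigr => i _; case: ifP.
Qed.

Lemma combD F m m' : comb F (fun i => m i + m' i)%N = comb F m + comb F m'.
Proof. by rewrite -big_split; apply: eq_bigr => i _; rewrite /= mulrnDr. Qed.

(** Rows outside [F] are zeroed rather than deleted, so that all [F] share one matrix format. *)
Definition facemx F : 'M[int]_(size A, d) :=
  \matrix_(i, j) (if i \in F then A`_i 0 j else 0).

Lemma row_facemx F (i : I) : row i (facemx F) = if i \in F then A`_i else 0.
Proof.
by apply/rowP => j; rewrite !mxE; case: ifP => // _; rewrite mxE.
Qed.

Lemma comb_mx F m : comb F m = (\row_i (m i)%:Z) *m facemx F.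
Proof.
rewrite mulmx_sum_row /comb big_mkcond; apply: eq_bigr => i _.
rewrite row_facemx mxE; case: ifP => _; last by rewrite scaler0.
by rewrite -natz scaler_nat.
Qed.

Definition cspan F x := exists c : 'rV[C]_(size A), x = c *m mxK C (facemx F).

Lemma cspanD F x y : cspan F x -> cspan F y -> cspan F (x + y).
Proof. by move=> [c ->] [c' ->]; exists (c + c'); rewrite mulmxDl. Qed.

Lemma cspanZ F (l : C) x : cspan F x -> cspan F (l *: x).
Proof. by move=> [c ->]; exists (l *: c); rewrite scalemxAl. Qed.

Lemma cspanN F x : cspan F x -> cspan F (- x).
Proof. by move=> Fx; rewrite -scaleN1r; apply: cspanZ. Qed.

Lemma cspanB F x y : cspan F x -> cspan F y -> cspan F (x - y).
Proof. by move=> Fx Fy; apply: cspanD => //; apply: cspanN. Qed.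

(* The localisation [NA + ZF], described as the set of [z] such that [z + NF]
   meets [NA]. *)
Definition locS F z := exists m, inNA A (z + comb F m).

(** Adding the absolute values of the entries of [k] to the multiplicities compensates its negative
    entries. *)
Lemma locS_mx F z (k : 'rV[int]_(size A)) :
  locS F z -> locS F (z + k *m facemx F).
Proof.
move=> [m zm]; exists (fun i => m i + absz (k 0%R i))%N.
have -> : z + k *m facemx F + comb F (fun i => m i + absz (k 0%R i))%N =
    (z + comb F m) + comb F (fun i => absz (k 0 i + Posz (absz (k 0 i)))).
  rewrite combD -!addrA; congr (_ + _); rewrite addrCA; congr (_ + _).
  rewrite !comb_mx -mulmxDl; congr (_ *m _); apply/rowP => i.
  have absE (v : int) : v + Posz (absz v) = Posz (absz (v + Posz (absz v))).
    by lia.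
  by rewrite !mxE; exact: absE.
by apply: inNAD => //; apply: inNA_comb.
Qed.

(** The groups (CF cap Z^d) / ZF have bounded exponent by [row_span_ker]; the product over the
    finitely many [F] serves them all. *)
Lemma lattice_exponent : exists2 M : nat, (0 < M)%N &
  forall F z, cspan F (zc z) -> exists k, M%:R *: z = k *m facemx F.
Proof.
have /choice[N NP] : forall F, exists N : nat, (0 < N)%N /\
    forall z, cspan F (zc z) -> exists k, N%:R *: z = k *m facemx F.
  move=> F; have [N N0 [B [BK BZ]]] := row_span_ker C (facemx F).
  exists N; split=> // z /BK zB; apply: BZ.
  by apply: (@mxK_inj C); rewrite mxKM zB mxK0.
exists (\prod_F N F)%N => [|F z /(proj2 (NP F))[k kE]].
  by rewrite prodn_gt0 // => F; case: (NP F).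
rewrite (bigD1 F) //= mulnC natrM -scalerA kE.
by rewrite scalemxAl; eexists.
Qed.

(* Saito's preorder: [x] precedes [x + b]. *)
Definition prec x b := exists g : Spoly R d, vanishOut A b g /\ ev g x != 0.

Lemma ev_prod (T : finType) (Q : pred T) (g : T -> Spoly R d) x :
  ev (\prod_(t | Q t) g t) x = \prod_(t | Q t) ev (g t) x.
Proof.
by elim/big_ind2: _ => [|f1 l1 f2 l2 <- <-|//]; [exact: ev1 | exact: evM].
Qed.

(** If [b + z] were not in S_F, then [g] would vanish on a translate of NF inside NA, hence on its
    Zariski closure [z] + CF, which contains [x]. *)
Lemma prec_locS x b F y z :
  prec x b -> cspan F y -> x = y + zc z -> locS F z -> locS F (b + z).
Proof.
move=> [g [gb gx]] [c yE] xE [m zm]; apply: contrapT => nloc.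
case/negP: gx; apply/eqP.
pose Y p := exists m', p = zc (z + comb F (fun i => m i + m' i)%N).
have Yrow p i : Y p -> Y (p + row i (mxK C (facemx F))).
  move=> [m' ->]; exists (fun j => m' j + (j == i))%N.
  rewrite -map_row row_facemx -[map_mx _ _]/(zc _) -mxKD; congr (zc _).
  rewrite -addrA; congr (_ + _); rewrite !combD -addrA; congr (_ + (_ + _)).
  rewrite /comb; case: ifP => iF.
    by rewrite (bigD1 i) //= eqxx big1 ?addr0 // => j /andP[_ /negPf->].
  rewrite big1 // => j jF; case: eqP => // ji; by rewrite -ji jF in iF.
have Y0 p : Y p -> ev g p = 0.
  move=> [m' ->]; apply: gb.
    by rewrite combD addrA; apply: inNAD => //; apply: inNA_comb.
  by move=> H; apply: nloc; exists (fun i => m i + m' i)%N; rewrite -addrA.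
have YE : Y (zc (z + comb F m)).
  exists (fun=> 0%N); congr (zc (_ + _)).
  by apply: eq_bigr => i _; rewrite addn0.
have := ev_span_eq0 Yrow Y0 (c - mxK C (\row_i (m i)%:Z)) YE.
rewrite mulmxBl -mxKM -comb_mx -yE mxKD xE => <-; congr (ev _ _).
by rewrite [y - _]addrC addrA addrK addrC.
Qed.

(** CF is the kernel of an integer matrix; a column on which [x - zc b] is nonzero gives the affine
    form. *)
Lemma affine_separation F x b : ~ cspan F (x - zc b) ->
  exists g : Spoly R d, ev g x != 0 /\
    forall y, cspan F (y - zc b) -> ev g y = 0.
Proof.
move=> nx; have [N N0 [B [BK _]]] := row_span_ker C (facemx F).
have [j xj] : exists j, ((x - zc b) *m mxK C B) 0 j != 0.
  apply: contrapT => H; apply: nx; apply/BK/rowP => j; rewrite [RHS]mxE.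
  by apply/eqP/negPn/negP => xj; apply: H; exists j.
pose g : Spoly R d := \sum_i ('X_i - (zc b 0 i)%:MP) * (mxK C B i j)%:MP.
have gE y : ev g y = ((y - zc b) *m mxK C B) 0 j.
  rewrite ev_sum mxE; apply: eq_bigr => i _.
  rewrite evM ev_const /ev mevalB mevalXU mevalC; congr (_ * _).
  by rewrite !mxE.
exists g; split=> [|y /BK yB]; first by rewrite gE.
by rewrite gE yB mxE.
Qed.

(* Either [b0 + NF] misses [NA - b], and an affine form does it, or it meets
   it, and what remains is covered by finitely many translates of the cones
   [N(F :\ i)]. *)
Lemma locS_prec_cone x b F b0 :
  (forall F' y z, cspan F' y -> x = y + zc z -> locS F' z -> locS F' (b + z)) ->
  inNA A b0 ->
  exists g : Spoly R d, ev g x != 0 /\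
    forall m, ~ inNA A (b + (b0 + comb F m)) -> ev g (zc (b0 + comb F m)) = 0.
Proof.
move=> xb; have [n] := ubnP #|F|; elim: n F b0 => // n IHn F b0 Fn b0A.
have [[u uA]|nou] :=
    pselect (exists u, inNA A (b + (b0 + comb F u))); last first.
  have [|g [gx g0]] := @affine_separation F x b0.
    move=> Fx; have [|m] := xb F _ b0 Fx (esym (subrK _ _)).
      by exists (fun=> 0%N); apply: inNAD => //; apply: inNA_comb.
    by rewrite -addrA => mA; apply: nou; exists m.
  exists g; split=> // m _; apply: g0; exists (mxK C (\row_i (m i)%:Z)).
  by rewrite mxKD addrAC subrr add0r comb_mx mxKM.
(* Slice the cone by fixing the multiplicity [k] of a generator [i]; each slice is a translated cone
   on fewer generators. *)
have /choice[G GP] : forall ik : I * nat, exists g : Spoly R d, ik.1 \in F ->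
    ev g x != 0 /\ forall m,
      ~ inNA A (b + (b0 + A`_(ik.1) *+ ik.2 + comb (F :\ ik.1) m)) ->
      ev g (zc (b0 + A`_(ik.1) *+ ik.2 + comb (F :\ ik.1) m)) = 0.
  move=> [i k] /=.
  have [iF|_] := boolP (i \in F); last by exists 0.
  have [| |g gP] := IHn (F :\ i) (b0 + A`_i *+ k).
  - rewrite ltnS in Fn; apply: leq_trans Fn.
    by rewrite [in X in (_ < X)%N](cardsD1 i) iF.
  - apply: inNAD => //; have := inNA_comb [set i] (fun=> k).
    by rewrite /comb big_set1.
  by exists g.
exists (\prod_(i in F) \prod_(k < u i) G (i, val k)); split=> [|m mA].
  rewrite ev_prod; apply/prodf_neq0 => i iF.
  by rewrite ev_prod; apply/prodf_neq0 => k _; case: (GP (i, val k) iF).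
(* If [m] dominated [u] on [F], the point shifted by [b] would lie in NA. So it lies in one of the
   slices whose polynomial is a factor. *)
have [i [iF mi]] : exists i, i \in F /\ (m i < u i)%N.
  apply: contrapT => H; apply: mA.
  have -> : comb F m = comb F u + comb F (fun i => m i - u i)%N.
    rewrite -combD; apply: eq_bigr => i iF; rewrite subnKC //.
    by rewrite leqNgt; apply/negP => mi; apply: H; exists i.
  rewrite addrA addrA -[b + b0 + _]addrA.
  by apply: inNAD => //; apply: inNA_comb.
rewrite ev_prod (bigD1 i) //= ev_prod (bigD1 (Ordinal mi)) //=.
have mE : b0 + comb F m = b0 + A`_i *+ m i + comb (F :\ i) m.
  by rewrite -addrA /comb (big_setD1 i).
by rewrite mE (proj2 (GP (i, m i) iF)) /= -?mE // !mul0r.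
Qed.

(** For the converse, the cone on all generators with apex 0 is NA itself. *)
Lemma precP x b : prec x b <->
  forall F y z, cspan F y -> x = y + zc z -> locS F z -> locS F (b + z).
Proof.
split=> [xb F y z|xb]; first exact: prec_locS.
have [g [gx g0]] := locS_prec_cone setT xb inNA0.
exists g; split=> // c [m ->] bc.
have mE : \sum_(i < size A) A`_i *+ m i = 0 + comb setT m.
  by rewrite add0r; apply: eq_bigl => i; rewrite inE.
by rewrite mE; apply: g0; rewrite -mE.
Qed.

End Localisations.

(** * Classification by finitely many invariants *)

Section FiniteClassification.
Variable X : Type.
Implicit Types (P : X -> Prop) (E : X -> X -> Prop).

(** The hypotheses are symmetric in [x] and [y], so [E] follows in both directions; an inclusion may
    therefore serve as [E]. *)
Definition finitely_classified P E :=
  exists (T : finType) (g : X -> T),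
    forall x y, P x -> P y -> g x = g y -> E x y.

(** The new invariant is a dependent pair: the value of [h], then the invariant chosen for that
    fibre. *)
Lemma finitely_classified_split (I : finType) (h : X -> I) P E :
  (forall i, finitely_classified (fun x => P x /\ h x = i) E) ->
  finitely_classified P E.
Proof.
move=> H; have /choice[Tg TgP] : forall i, exists Tg : {T : finType & X -> T},
    forall x y, P x /\ h x = i -> P y /\ h y = i -> projT2 Tg x = projT2 Tg y ->
    E x y.
  by move=> i; have [T [g gP]] := H i; exists (existT _ T g).
exists {i : I & projT1 (Tg i)}.
exists (fun x => existT _ (h x) (projT2 (Tg (h x)) x)) => x y Px Py exy.
have hxy : h x = h y := congr1 (@projT1 _ _) exy.
apply: (TgP (h x)) => //; move: exy; rewrite -hxy.
by move/eqP; rewrite eq_Tagged => /eqP.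
Qed.

End FiniteClassification.

Lemma int_row_residue n N : (0 < N)%N ->
  exists (T : finType) (r : 'rV[int]_n -> T),
    forall z z', r z = r z' -> exists u, z - z' = N%:R *: u.
Proof.
case: N => // N _; exists {ffun 'I_n -> 'I_N.+1}.
(* Remainders lie between 0 and [N], so the absolute value and [inord] lose nothing. *)
pose res (a : int) : 'I_N.+1 := inord `|(a %% N.+1%:Z)%Z|.
exists (fun z => [ffun j => res (z 0 j)]) => z z' rE.
exists (\row_j divz (z 0 j - z' 0 j) N.+1%:Z).
apply/rowP => j; rewrite !mxE mulrC natz.
have := congr1 (fun f : {ffun 'I_n -> 'I_N.+1} => val (f j)) rE.
rewrite !ffunE /res /=.
have small (a : int) : (`|(a %% N.+1%:Z)%Z| < N.+1)%N.
  by rewrite -ltz_nat gez0_abs ?modz_ge0 // ltz_pmod.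
rewrite !inordK // => /(congr1 Posz); rewrite !gez0_abs ?modz_ge0 // => eqm.
rewrite divzK //; have /eqP := eqm; rewrite eqz_mod_dvd; exact.
Qed.

(** * Finitely many annihilators *)

Section Finiteness.
Variables (R : realType) (d : nat) (A : seq (Zd d)).
Local Notation C := (Cx R).
Local Notation zc := (@mxK C 1 d).
Local Notation I := ('I_(size A)).
Implicit Types (F : {set I}) (G : {set {set I}}) (a b z : Zd d).
Implicit Types (x y w : 'rV[C]_d) (P : LDop R d).

Lemma annL_prec x P : annL A x P <-> inD A P /\ forall a b,
  prec A x b -> prec A (x + zc (a + b)) (- (a + b)) ->
  ev (wcoef a P) (x + zc b) = 0.
Proof.
split=> -[PD PJ]; split=> // a b.
  move=> [g [gb gx]] [h [hb hx]]; have /eqP := PJ a b g h gb hb.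
  by rewrite !mulf_eq0 (negPf gx) (negPf hx) orbF /= => /eqP.
move=> g h gb hab; have [->|gx] := eqVneq (ev g x) 0; first by rewrite !mulr0.
have [->|hx] := eqVneq (ev h (x + zc (a + b))) 0; first by rewrite mul0r.
by rewrite PJ ?mul0r ?mulr0 //; [exists g | exists h].
Qed.

(* The subspaces [C F] containing [x] up to [Z^d]. *)
Definition integral_faces x : {set {set I}} :=
  [set F | `[< exists z, cspan (A := A) F (x - zc z) >]].

Lemma integral_facesP x F :
  reflect (exists z, cspan F (x - zc z)) (F \in integral_faces x).
Proof. by rewrite inE; apply: asboolP. Qed.

Lemma integral_faces_span x F y z :
  cspan F y -> x = y + zc z -> F \in integral_faces x.
Proof. by move=> Fy ->; apply/integral_facesP; exists z; rewrite addrK. Qed.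

Lemma integral_faces_zc x z : integral_faces (x + zc z) = integral_faces x.
Proof.
apply/setP => F; apply/integral_facesP/integral_facesP => -[t Ft].
  by exists (t - z); rewrite mxKB opprB addrA.
by exists (t + z); rewrite mxKD [zc t + _]addrC opprD addrA addrK.
Qed.

(** This is [ker_split] for the intersection of the CF with [F] in [G]; sets outside [G] get the
    zero matrix, which imposes no condition. *)
Lemma face_intersection G : exists2 N : nat, (0 < N)%N &
  (forall x, (forall F, F \in G -> exists z, cspan F (x - zc z)) ->
     exists w z, (forall F, F \in G -> cspan F w) /\ N%:R *: x = w + zc z) /\
  exists U : 'M[int]_d, (forall i F, F \in G -> cspan F (zc (row i U))) /\
    forall w, (forall F, F \in G -> cspan F w) ->
      exists c : 'rV[C]_d, w = c *m mxK C U.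
Proof.
have /choice[B BP] : forall F, exists B : 'M[int]_d,
    forall x, F \in G /\ cspan F x \/ F \notin G <-> x *m mxK C B = 0.
  move=> F; have [N _ [B [BK _]]] := row_span_ker C (facemx F).
  have [FG|FG] := boolP (F \in G).
    by exists B => x; rewrite -BK; split=> [[[]|]|] //; left.
  by exists 0 => x; rewrite mxK0 mulmx0; split=> // _; right.
have [m [B' [B'K B'int]]] := stack_mx C B.
have B'P x : (forall F, F \in G -> cspan F x) <-> x *m mxK C B' = 0.
  rewrite -B'K; split=> [xG F|xB F FG].
    apply/BP; have [FG|] := boolP (F \in G); last by right.
    by left; split=> //; apply: xG.
  by case/BP: (xB F) => [[]|]; rewrite ?FG.
have [N N0 [splitB [U UB Uspan]]] := ker_split C B'.
exists N => //; split=> [x xG|].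
  have [F|y yE] := B'int x.
    have [FG|FG] := boolP (F \in G).
      have [z Fz] := xG F FG; exists (z *m B F).
      have /BP : F \in G /\ cspan F (x - zc z) \/ F \notin G by left.
      by rewrite mulmxBl mxKM => /eqP; rewrite subr_eq0 => /eqP.
    have /BP -> : F \in G /\ cspan F x \/ F \notin G by right.
    by exists 0; rewrite mxK0.
  have [w [z [wB xE]]] := splitB x y yE.
  by exists w, z; split=> //; apply/B'P.
exists U; split=> [i|w /B'P]; last exact: Uspan.
apply/B'P; rewrite -mxKM -row_mul UB; apply/rowP => j; rewrite !mxE.
by rewrite mulr0z.
Qed.

Lemma prec_translate x w b :
  (forall F, F \in integral_faces x -> cspan F w) ->
  integral_faces (x + w) = integral_faces x -> prec A (x + w) b -> prec A x b.
Proof.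
move=> Ww Gw /precP xwb; apply/precP => F y z Fy xE Fz.
apply: (xwb F (y + w) z) => //; last by rewrite xE addrAC.
by apply: cspanD => //; apply: Ww; apply: integral_faces_span xE.
Qed.

Lemma annL_translate x w P :
  (forall F, F \in integral_faces x -> cspan F w) ->
  integral_faces (x + w) = integral_faces x -> annL A x P -> annL A (x + w) P.
Proof.
move=> Ww Gw /annL_prec[PD Px]; apply/annL_prec; split=> // a b.
have [M M0 MP] := lattice_exponent R A.
have [N _ [_ [U [Urow Uspan]]]] := face_intersection (integral_faces x).
have [c wE] := Uspan w Ww.
move=> /(prec_translate Ww Gw) xb.
rewrite addrAC => /prec_translate; rewrite !integral_faces_zc => /(_ Ww).
rewrite addrAC !integral_faces_zc => /(_ Gw) xab.
(* The points where the degree [a] coefficient must vanish. [Y] is stable under the rows of [M U],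
   which lie in ZF for every integral face [F], so the coefficient also vanishes at
   [x + zc b + w]. *)
pose Y p := exists b', [/\ p = x + zc b', prec A x b' &
  prec A (x + zc (a + b')) (- (a + b'))].
have mulM F y z i : cspan F y -> x = y + zc z ->
    exists k, M%:R *: row i U = k *m facemx F.
  by move=> Fy xE; apply: MP; apply: Urow; apply: integral_faces_span xE.
have Yrow p i : Y p -> Y (p + row i (mxK C (M%:R *: U))).
  move=> [b' [-> xb' xab']]; exists (b' + M%:R *: row i U); split.
  - by rewrite mxKD addrA -map_row linearZ.
  - apply/precP => F y z Fy xE Fz; have [k kE] := mulM F y z i Fy xE.
    rewrite kE addrAC; apply: locS_mx.
    by move/precP: xb' => /(_ F y z Fy xE Fz).
  - apply/precP => F y z Fy xE Fz.
    move: xE; set v := M%:R *: row i U => xE.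
    have [k kE] : exists k, v = k *m facemx F.
      apply: (mulM F y (z - (a + (b' + v)))) => //.
      by rewrite mxKB addrA -xE addrK.
    have Fzv : locS F (z - v) by rewrite kE -mulNmx; apply: locS_mx.
    have xE' : x + zc (a + b') = y + zc (z - v).
      rewrite mxKB addrA -xE -addrA -mxKB; congr (_ + zc _).
      by rewrite addrA addrK.
    rewrite addrA opprD -addrA [- v + _]addrC.
    by move/precP: xab' => /(_ F y _ Fy xE' Fzv).
have Y0 p : Y p -> ev (wcoef a P) p = 0.
  by move=> [b' [-> xb' xab']]; apply: Px.
have := ev_span_eq0 Yrow Y0 (M%:R^-1 *: c) (ex_intro _ b (And3 erefl xb xab)).
rewrite mxKZ -scalemxAl -scalemxAr scalerA mulVf ?pnatr_eq0 -?lt0n // scale1r.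
by rewrite -wE addrAC.
Qed.

Lemma annL_lattice_translate x z z' P :
  (forall F k, cspan (A := A) F (x - zc k) ->
     locS F (z + k) <-> locS F (z' + k)) ->
  annL A (x + zc z) P -> annL A (x + zc z') P.
Proof.
move=> zz' /annL_prec[PD Px]; apply/annL_prec; split=> // a b xb xab.
have uE (u v w : Zd d) : u + (v + w - u) = w + v by rewrite addrC subrK addrC.
(* Degree [b] from [x + zc z'] and degree [b + z' - z] from [x + zc z] reach the same point. *)
have cE : x + zc z + zc (b + z' - z) = x + zc z' + zc b.
  by rewrite -[LHS]addrA -[RHS]addrA -!mxKD uE.
rewrite -cE; apply: Px; apply/precP => F y t Fy xE Ft.
  have Fk : cspan F (x - zc (t - z)).
    by rewrite mxKB opprB addrA xE addrK.
  have : locS F (z' + (t - z)) by apply/zz' => //; rewrite addrC subrK.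
  move/(proj1 (precP _ _ _) xb F y _ Fy).
  have -> : b + z' - z + t = b + (z' + (t - z)).
    by rewrite -!addrA [- z + t]addrC.
  apply; apply: (addIr (zc z)).
  rewrite addrAC xE -[LHS]addrA -[RHS]addrA -!mxKD.
  by rewrite addrA subrK [t + z']addrC.
have tE : a + (b + z' - z) = a + b + z' - z by rewrite !addrA.
have xE' : x + zc (z' + (a + b)) = y + zc t.
  by rewrite -xE -[RHS]addrA -mxKD tE uE.
pose k := t - (z' + (a + b)).
have Fk : cspan F (x - zc k).
  by rewrite mxKB opprB addrA xE' addrK.
have -> : - (a + (b + z' - z)) + t = z + k.
  by rewrite tE [_ + z']addrC /k opprB -addrA [- _ + t]addrC.
apply/zz' => //; have -> : z' + k = - (a + b) + t.
  by rewrite /k addrCA opprD addNKr addrC.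
by apply: (proj1 (precP _ _ _) xab F y t Fy) => //; rewrite -xE' -addrA -mxKD.
Qed.


(** Three successive invariants: the integral faces, the residue mod [N] of the integral part of
    [N x], and the set [sig] of membership conditions. *)
Lemma annL_finitely_classified :
  finitely_classified (fun=> True)
    (fun x x' => forall P, annL A x P -> annL A x' P).
Proof.
apply: (finitely_classified_split (h := integral_faces)) => G.
have [N N0 [splitN _]] := face_intersection G.
have /choice[wz wzP] : forall x, exists wz : 'rV[C]_d * Zd d,
    True /\ integral_faces x = G ->
    (forall F, F \in G -> cspan F wz.1) /\ N%:R *: x = wz.1 + zc wz.2.
  move=> x; have [xG|xG] := eqVneq (integral_faces x) G; last first.
    by exists (0, 0) => -[_ /eqP]; rewrite (negPf xG).
  have [F|w [z wz]] := splitN x; first by rewrite -xG => /integral_facesP.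
  by exists (w, z).
have [T [r rP]] := int_row_residue d N0.
apply: (finitely_classified_split (h := fun x => r (wz x).2)) => t.
(* A base point [x0] of the class; all other members are written as [x0] plus an integral vector
   plus a vector common to all CF, [F] in [G]. *)
have [[x0 [x0G x0t]]|none] := pselect (exists x,
    (True /\ integral_faces x = G) /\ r (wz x).2 = t); last first.
  by exists unit, (fun=> tt) => x y xP; case: none; exists x.
have /choice[wu wuP] : forall x, exists wu : 'rV[C]_d * Zd d,
    (True /\ integral_faces x = G) /\ r (wz x).2 = t ->
    (forall F, F \in G -> cspan F wu.1) /\ x = x0 + zc wu.2 + wu.1.
  move=> x; have [[xG xt]|nx] := pselect
      ((True /\ integral_faces x = G) /\ r (wz x).2 = t); last first.
    by exists (0, 0) => xP; case: nx.
  have [u uE] := rP _ _ (etrans xt (esym x0t)).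
  have [w0G x0E] := wzP x0 x0G; have [wG xE] := wzP x xG.
  exists (N%:R^-1 *: ((wz x).1 - (wz x0).1), u) => _; split=> [F FG|].
    by apply: cspanZ; apply: cspanB; [apply: wG | apply: w0G].
  have NC : N%:R != 0 :> C by rewrite pnatr_eq0 -lt0n.
  apply: (scalerI NC); rewrite scalerDr (scalerDr _ x0) scalerA mulfV //.
  rewrite scale1r -mxKZ -uE.
  by rewrite xE x0E mxKB; apply/rowP => j; rewrite !mxE; ring.
have [M M0 MP] := lattice_exponent R A.
have [T' [r' r'P]] := int_row_residue d M0.
(* Recording [k] only mod [M] suffices: two admissible [k] with equal residues differ by [M] times
   an integral vector of CF, hence by an element of ZF. *)
pose sig x : {set {set I} * T'} := [set p | `[< exists k, [/\ r' k = p.2,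
  cspan p.1 (x0 - zc k) & locS p.1 ((wu x).2 + k)] >]].
have transfer x y F k : sig x = sig y -> cspan F (x0 - zc k) ->
    locS F ((wu x).2 + k) -> locS F ((wu y).2 + k).
  move=> xy Fk xk; have : (F, r' k) \in sig x.
    by rewrite inE; apply/asboolP; exists k.
  rewrite xy inE => /asboolP[k' [/= rk Fk' yk']].
  have [v vE] := r'P _ _ (esym rk); have [|l lE] := MP F v.
    have -> : zc v = M%:R^-1 *: (x0 - zc k' - (x0 - zc k)).
      rewrite opprB addrC addrA subrK -mxKB vE mxKZ scalerA mulVf ?scale1r //.
      by rewrite pnatr_eq0 -lt0n.
    by apply: cspanZ; apply: cspanB.
  have -> : (wu y).2 + k = (wu y).2 + k' + l *m facemx F.
    by rewrite -lE -vE -addrA [k' + _]addrC subrK.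
  exact: locS_mx.
exists {set {set I} * T'}, sig => x y xP yP xy P.
have [wG xE] := wuP x xP; have [wG' yE] := wuP y yP.
have x0u u : integral_faces (x0 + zc u) = G.
  by rewrite integral_faces_zc; case: x0G.
have xG : integral_faces x = G by case: xP => [[]].
have yG : integral_faces y = G by case: yP => [[]].
have xw : x0 + zc (wu x).2 = x - (wu x).1 := canRL (addrK _) (esym xE).
(* Go from [x] to [y] in three moves: drop the CF part of [x], exchange the integral parts over
   [x0], add the CF part of [y]. *)
move=> Px; have Px0 : annL A (x0 + zc (wu x).2) P.
  rewrite xw; apply: annL_translate Px => [F|].
    by rewrite xG => FG; apply: cspanN; apply: wG.
  by rewrite -xw x0u.
have Py0 : annL A (x0 + zc (wu y).2) P.
  apply: annL_lattice_translate Px0 => F k Fk.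
  by split; apply: transfer => //; exact: esym.
have := annL_translate (w := (wu y).1) _ _ Py0; rewrite -yE x0u.
by apply; [exact: wG' | exact: yG].
Qed.

(** The ideal attached to a class is a union over its members, all of which have the same
    annihilator. *)
Lemma Ann_finitely_many :
  exists (n : nat) (V : 'I_n -> LDop R d -> Prop),
    forall (alpha : 'I_d -> C) (J : LDop R d -> Prop),
      L_ideal A alpha J -> exists k : 'I_n, forall P, Ann A J P <-> V k P.
Proof.
have [T [g gP]] := annL_finitely_classified.
exists #|T|, (fun k P => exists x, g x = enum_val k /\ annL A x P).
move=> alpha J JL.
exists (enum_rank (g (\row_i alpha i))) => P; rewrite (AnnE P JL) enum_rankK.
by split=> [xP|[x [gx]]]; [exists (\row_i alpha i) | apply: gP].
Qed.

End Finiteness.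

Theorem theorem7p6 (R : realType) (d : nat) (A : seq 'rV[int]_d) :
  generates_Zd A ->
  exists (n : nat) (I : 'I_n -> LDop R d -> Prop),
    forall (alpha : 'I_d -> Cx R) (J : LDop R d -> Prop),
      L_ideal A alpha J ->
      exists k : 'I_n, forall P : LDop R d, Ann A J P <-> I k P.
Proof. by move=> _; exact: Ann_finitely_many. Qed.
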